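(* Let $\mathcal Y$ be an antisymmetric coherent configuration and $L$ a transitive permutation group of odd order. Then $gb(\mathcal Y\uparrow L)\le\max\{gb(\mathcal Y),b\}$ where $b=gb(\mathrm{Inv}(L))$. Moreover, if $\mathcal Y$ is not complete, then $b(\mathcal Y\uparrow L)\le b(\mathcal Y)+\max\{0,\,b-\lceil(b(\mathcal Y)-1)/2\rceil\}$.
   Context: A coherent configuration on a finite set $\Omega$ is $(\Omega,S)$ with $S$ a partition of $\Omega\times\Omega$ such that $1_\Omega$ is a union of elements of $S$, $s^*=\{(\beta,\alpha):(\alpha,\beta)\in s\}\in S$, and for $r,s,t\in S$ the number $|\{\gamma:(\alpha,\gamma)\in r,(\gamma,\beta)\in s\}|$ is independent of $(\alpha,\beta)\in t$; relations are unions of elements of $S$, fibers are sets $\Gamma$ with $1_\Gamma\in S$; antisymmetric: every $s\in S$ with $s=s^*$ lies in $1_\Omega$; complete: all elements of $S$ are singletons. A fission is a configuration on the same set whose relations include those of the given one. For $\Pi\subseteq2^\Omega$ the $\Pi$-fission is the smallest fission in which each member of $\Pi$ is a union of fibers; $\Pi$ is a generalized base if the $\Pi$-fission is complete; $B\subseteq\Omega$ is a base if $\{\{\beta\}:\beta\in B\}$ is a generalized base; $gb$ and $b$ are the minimal sizes. $\mathrm{Inv}(L)=(\Delta,\text{orbits of }L\text{ on }\Delta^2)$. Exponentiation: for $\mathcal Y=(\Gamma,T)$ and $L\le\mathrm{Sym}(\Delta)$, $\Delta=\{1,\dots,m\}$, with $t_1\otimes\dots\otimes t_m=\{(\alpha,\beta)\in\Gamma^m\times\Gamma^m:(\alpha_i,\beta_i)\in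 t_i\ \forall i\}$ and $L$ acting on $\Gamma^m$ by permuting coordinates, $\mathcal Y\uparrow L=(\Gamma^m,\{\bigcup_{l\in L}t^l:t=t_1\otimes\dots\otimes t_m,\ t_i\in T\})$. *)

(* Defs.v *)
(* Coherent configurations on a finite type T are given by
   their set S of basic relations, S : {set {set T * T}}. *)
From mathcomp Require Import all_boot all_order all_fingroup.
Set Implicit Arguments. Unset Strict Implicit. Unset Printing Implicit Defensive.

Section CC.
Variable T : finType.
Implicit Types (S : {set {set T * T}}) (r s t : {set T * T}).

Definition diag (A : {set T}) : {set T * T} := [set (x, x) | x in A].
Definition rel_inv s : {set T * T} := [set (p.2, p.1) | p in s].
Definition is_union S r : Prop :=
  exists P : {set {set T * T}}, P \subset S /\ cover P = r.

Definition coherent S : Prop :=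
  [/\ partition S [set: T * T],
      is_union S (diag [set: T]),
      (forall s, s \in S -> rel_inv s \in S) &
      (forall r s t, r \in S -> s \in S -> t \in S ->
         forall a b a' b', (a, b) \in t -> (a', b') \in t ->
           #|[set c | ((a, c) \in r) && ((c, b) \in s)]|
           = #|[set c | ((a', c) \in r) && ((c, b') \in s)]|)].

Definition fiber S (X : {set T}) : Prop := diag X \in S.
Definition union_of_fibers S (X : {set T}) : Prop :=
  exists F : {set {set T}}, (forall Y, Y \in F -> fiber S Y) /\ cover F = X.

Definition cc_antisymmetric S : Prop :=
  forall s, s \in S -> rel_inv s = s -> s \subset diag [set: T].
Definition cc_complete S : Prop := forall s, s \in S -> #|s| = 1.

Definition finer S S' : Prop := forall r, is_union S r -> is_union S' r.
Definition fission S S' : Prop := coherent S' /\ finer S S'.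

Definition Pi_fission S (Pi : {set {set T}}) S' : Prop :=
  [/\ fission S S',
      (forall X, X \in Pi -> union_of_fibers S' X) &
      (forall S'', fission S S'' -> (forall X, X \in Pi -> union_of_fibers S'' X) ->
         finer S' S'')].

Definition gen_base S (Pi : {set {set T}}) : Prop :=
  exists S', Pi_fission S Pi S' /\ cc_complete S'.
Definition base S (B : {set T}) : Prop := gen_base S [set [set x] | x in B].

Definition is_gb S (n : nat) : Prop :=
  (exists Pi, gen_base S Pi /\ #|Pi| = n) /\
  (forall Pi, gen_base S Pi -> n <= #|Pi|).
Definition is_b S (n : nat) : Prop :=
  (exists B, base S B /\ #|B| = n) /\
  (forall B, base S B -> n <= #|B|).
End CC.

Section Expo.
Variables (G : finType) (m : nat).
Local Notation pt := {ffun 'I_m -> G}.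

Definition tensor (f : {ffun 'I_m -> {set G * G}}) : {set pt * pt} :=
  [set p : pt * pt | [forall i, (p.1 i, p.2 i) \in f i]].
Definition permc (l : {perm 'I_m}) (a : pt) : pt := [ffun i => a ((l^-1)%g i)].
Definition rel_act (l : {perm 'I_m}) (t : {set pt * pt}) : {set pt * pt} :=
  [set (permc l p.1, permc l p.2) | p in t].

Definition expo (S : {set {set G * G}}) (L : {set {perm 'I_m}}) : {set {set pt * pt}} :=
  [set \bigcup_(l in L) rel_act l (tensor f)
     | f in [set f : {ffun 'I_m -> {set G * G}} | [forall i, f i \in S]]].
End Expo.

Definition Inv (m : nat) (L : {set {perm 'I_m}}) : {set {set 'I_m * 'I_m}} :=
  [set [set ((l : {perm _}) p.1, l p.2) | l in L] | p in [set: 'I_m * 'I_m]].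

(* Main.v *)
Require Import Defs.
From mathcomp Require Import all_boot all_order all_fingroup.
Set Implicit Arguments. Unset Strict Implicit. Unset Printing Implicit Defensive.

(** A set [Pi] is a generalized base iff every coherent fission in which its members are
    unions of fibers is complete, so fix such a fission [W] of the exponentiation.  The
    Hamming distance is constant on the classes of [W]; hence on each line of the Hamming
    graph the points nearest to a product set that is a union of fibers are recognisable.
    This lets chosen sets or points of [G^m] mark subsets of [G] and of the coordinates on
    every line.  If all coordinates and all members of a generalized base of [S] are marked,
    the quotient of [W] by "equal [i]-th coordinate" is a coherent fission of [S] on [G],
    hence complete for each [i], and so is [W].

    For the first bound, a single "staircase" set, with pieces Delta^k x {q}^(m-k), marks
    all coordinates together with one member Delta of the generalized base of [S]; the
    other members D are marked by the powers D^m.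

    For the second bound, a pair of base points p, q swapped along a set A of coordinates
    marks p, q and A, because antisymmetry distinguishes (p, q) from (q, p); each of the
    remaining sets costs one extra point.  A marked constant point is a singleton fiber, and
    the quotient of its neighbourhood (in one basic relation) by the directions of the lines
    is a coherent fission of [Inv L], which is therefore complete: all coordinates are
    marked. *)

(** * Partitions of [T * T] and unions of their classes *)

Section Partition.
Variables (T : finType) (S : {set {set T * T}}).
Hypothesis pS : partition S [set: T * T].

Lemma mem_class p : p \in pblock S p.
Proof. by rewrite mem_pblock (cover_partition pS) inE. Qed.

Lemma class_in p : pblock S p \in S.
Proof. by rewrite pblock_mem // (cover_partition pS) inE. Qed.

Lemma class_eq r p : r \in S -> p \in r -> pblock S p = r.
Proof. by move=> rS pr; apply: def_pblock => //; apply: partition_trivIset pS. Qed.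

Lemma class_ind r p q : r \in S -> pblock S p = pblock S q -> p \in r -> q \in r.
Proof. by move=> rS e pr; rewrite -(class_eq rS pr) e mem_class. Qed.

(** Replaces the choice of a subfamily by invariance under equality of classes, the form in which
    relations are handled below. *)
Lemma is_unionP r :
  is_union S r <-> (forall p q, pblock S p = pblock S q -> p \in r -> q \in r).
Proof.
split=> [[P [PS <-]] p q e /bigcupP[s sP ps]|H].
  by apply/bigcupP; exists s => //; apply: class_ind e ps; apply: (subsetP PS).
exists [set pblock S p | p in r]; split.
  by apply/subsetP=> _ /imsetP[p _ ->]; apply: class_in.
apply/setP=> q; apply/bigcupP/idP=> [[_ /imsetP[p pr ->] qp]|qr].
  by apply: (H p) => //; rewrite (class_eq (class_in p) qp).
by exists (pblock S q); [apply: imset_f | apply: mem_class].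
Qed.

Lemma finerI (S0 : {set {set T * T}}) :
  (forall r p q, r \in S0 -> pblock S p = pblock S q -> p \in r -> q \in r) ->
  finer S0 S.
Proof.
move=> H r [P [PS <-]]; apply/is_unionP=> p q e /bigcupP[s sP ps].
by apply/bigcupP; exists s => //; apply: H e ps; apply: (subsetP PS).
Qed.

Lemma finerE (S0 : {set {set T * T}}) r p q :
  finer S0 S -> r \in S0 -> pblock S p = pblock S q -> p \in r -> q \in r.
Proof.
move=> fS rS0; move: p q; apply/is_unionP; apply: fS; exists [set r].
by rewrite sub1set rS0 /cover big_set1.
Qed.

Lemma completeI :
  (forall p q, pblock S p = pblock S q -> p = q) -> cc_complete S.
Proof.
move=> inj s sS; have /set0Pn[p ps] : s != set0.
  by apply: contraTneq sS => ->; case/and3P: pS.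
apply/eqP/cards1P; exists p; apply/setP=> q; rewrite inE; apply/idP/eqP=> [qs|->//].
by apply: inj; rewrite !(@class_eq s).
Qed.

Lemma completeE : cc_complete S -> forall p q, pblock S p = pblock S q -> p = q.
Proof.
move=> cS p q e; have /eqP/cards1P[x xE] := cS _ (class_in p).
have := mem_class p; have := mem_class q.
by rewrite -e xE !inE => /eqP-> /eqP->.
Qed.

End Partition.

(** * Coherent configurations in terms of the class of a pair *)

Section Coherent.
Variables (T : finType) (S : {set {set T * T}}).
Hypothesis cS : coherent S.

Lemma coherent_partition : partition S [set: T * T]. Proof. by case: cS. Qed.
Let pS := coherent_partition.

Lemma class_diag a b c : pblock S (a, a) = pblock S (b, c) -> b = c.
Proof.
case: cS => _ dS _ _ e; have /(_ e) := (is_unionP pS _).1 dS (a, a) (b, c).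
case/(_ _)/imsetP=> [|x _ [-> ->]//].
by apply/imsetP; exists a; rewrite ?inE.
Qed.

Lemma class_inv a b a' b' :
  pblock S (a, b) = pblock S (a', b') -> pblock S (b, a) = pblock S (b', a').
Proof.
case: cS => _ _ iS _ e; set r := rel_inv (pblock S (a, b)).
have rS : r \in S by apply/iS/class_in.
rewrite !(@class_eq _ _ pS r) //.
  by apply/imsetP; exists (a', b') => //; rewrite e mem_class.
by apply/imsetP; exists (a, b) => //; rewrite mem_class.
Qed.

Definition class_invariant (P : rel T) :=
  forall a b a' b', pblock S (a, b) = pblock S (a', b') -> P a b = P a' b'.

(** Sorting the midpoints by the classes of both steps writes the count as a sum of intersection
    numbers over the pairs of classes on which [P] and [Q] hold. *)
Lemma card_path_class (P Q : rel T) a b a' b' :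
  class_invariant P -> class_invariant Q -> pblock S (a, b) = pblock S (a', b') ->
  #|[set c | P a c && Q c b]| = #|[set c | P a' c && Q c b']|.
Proof.
move=> hP hQ e.
have key x y : #|[set c | P x c && Q c y]| = \sum_(r in S) \sum_(s in S)
    (if [exists p in r, P p.1 p.2] && [exists p in s, Q p.1 p.2]
     then #|[set c | ((x, c) \in r) && ((c, y) \in s)]| else 0).
  rewrite -sum1_card (partition_big (fun c => pblock S (x, c)) (mem S)) /=; last first.
    by move=> c _; apply: class_in.
  apply: eq_bigr => r rS.
  rewrite (partition_big (fun c => pblock S (c, y)) (mem S)) /=; last first.
    by move=> c _; apply: class_in.
  apply: eq_bigr => s sS.
  have hPr c : (x, c) \in r -> [exists p in r, P p.1 p.2] = P x c.
    move=> xr; apply/exists_inP/idP=> [[[p1 p2] pr /=]|]; last by exists (x, c).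
    by rewrite (hP _ _ x c) // !(@class_eq _ _ pS r).
  have hQs c : (c, y) \in s -> [exists p in s, Q p.1 p.2] = Q c y.
    move=> xr; apply/exists_inP/idP=> [[[p1 p2] pr /=]|]; last by exists (c, y).
    by rewrite (hQ _ _ c y) // !(@class_eq _ _ pS s).
  have eqc t p : t \in S -> (pblock S p == t) = (p \in t).
    by move=> tS; apply/eqP/idP=> [<-|/(class_eq pS tS)//]; apply: mem_class.
  case: ifP => h; rewrite -?sum1_card.
    apply: eq_bigl => c; rewrite !inE !eqc //; case xr: ((x, c) \in r); rewrite ?andbF //.
    case cy: ((c, y) \in s); rewrite ?andbF // !andbT.
    by rewrite -(hPr _ xr) -(hQs _ cy).
  rewrite big1 // => c; rewrite !inE !eqc // => /andP[/andP[PQ xr] cy].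
  by rewrite (hPr _ xr) (hQs _ cy) PQ in h.
rewrite !key; apply: eq_bigr => r rS; apply: eq_bigr => s sS; case: ifP => // _.
case: cS => _ _ _ /(_ r s _ rS sS (class_in pS (a, b))); apply.
  exact: mem_class.
by rewrite e mem_class.
Qed.

(** A triangle over one pair can be copied to any pair of the same class: the intersection number
    counting its third vertex is positive. Nearly every later argument rests on this. *)
Lemma class_transport a b a' b' c : pblock S (a, b) = pblock S (a', b') ->
  exists c', pblock S (a, c) = pblock S (a', c') /\ pblock S (c, b) = pblock S (c', b').
Proof.
move=> e.
pose P x y := pblock S (x, y) == pblock S (a, c).
pose Q x y := pblock S (x, y) == pblock S (c, b).
have hP : class_invariant P by move=> ? ? ? ?; rewrite /P => ->.
have hQ : class_invariant Q by move=> ? ? ? ?; rewrite /Q => ->.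
have E := card_path_class hP hQ e.
have : 0 < #|[set c | P a c && Q c b]| by apply/card_gt0P; exists c; rewrite inE /P /Q !eqxx.
by rewrite E => /card_gt0P[c']; rewrite inE => /andP[/eqP<- /eqP<-]; exists c'.
Qed.

Lemma class_eq_pt a b a' b' :
  pblock S (a, b) = pblock S (a', b') -> (a == b) = (a' == b').
Proof.
move=> e; apply/eqP/eqP=> h; move: e; rewrite h; first by move/class_diag.
by move/esym/class_diag.
Qed.

Lemma class_fst a b a' b' :
  pblock S (a, b) = pblock S (a', b') -> pblock S (a, a) = pblock S (a', a').
Proof.
by case/(class_transport a)=> c' [e _]; have := class_diag e; rewrite e => <-.
Qed.

Lemma class_snd a b a' b' :
  pblock S (a, b) = pblock S (a', b') -> pblock S (b, b) = pblock S (b', b').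
Proof. by move/class_inv/class_fst. Qed.

Lemma union_of_fibersP X : union_of_fibers S X <->
  (forall x y, pblock S (x, x) = pblock S (y, y) -> x \in X -> y \in X).
Proof.
split=> [[F [hF <-]] x y e /bigcupP[Y YF xY]|H].
  apply/bigcupP; exists Y => //.
  have: (y, y) \in diag Y by apply: (class_ind pS (hF _ YF) e); apply: imset_f.
  by case/imsetP=> z zY [->].
exists [set [set y | (y, y) \in pblock S (x, x)] | x in X]; split.
  move=> _ /imsetP[x xX ->]; rewrite /fiber.
  suff -> : diag [set y | (y, y) \in pblock S (x, x)] = pblock S (x, x) by apply: class_in.
  apply/setP=> -[y z]; apply/imsetP/idP=> [[t] | yz].
    by rewrite inE => h [-> ->].
  have E := esym (class_eq pS (class_in pS (x, x)) yz).
  by rewrite -(class_diag E) in yz *; exists y; rewrite ?inE.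
apply/setP=> y; apply/bigcupP/idP=> [[_ /imsetP[x xX ->]]|yX].
  rewrite inE => /(class_eq pS (class_in pS _)) e; exact: H (esym e) xX.
by exists [set z | (z, z) \in pblock S (y, y)]; [apply: imset_f | rewrite inE mem_class].
Qed.

End Coherent.

(** * Configurations given as level sets of a colouring *)

Section Colouring.
Variables (T C : finType) (col : T * T -> C).

Lemma preim_classP p q :
  pblock (preim_partition col setT) p = pblock (preim_partition col setT) q <-> col p = col q.
Proof.
have pS := preim_partitionP col setT.
have E : {in setT & &, equivalence_rel [rel x y | col x == col y]}.
  by move=> x y z _ _ _; split=> /= [|/eqP->].
split=> [e|e].
  have := mem_class pS q; rewrite -e pblock_equivalence_partition ?inE //.
  by move/eqP.
apply/eqP; rewrite eq_pblock ?(partition_trivIset pS) ?(cover_partition pS) ?inE //.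
by rewrite pblock_equivalence_partition ?inE //= e.
Qed.

Lemma coherent_colouring :
  (forall a b c, col (a, a) = col (b, c) -> b = c) ->
  (forall a b a' b', col (a, b) = col (a', b') -> col (b, a) = col (b', a')) ->
  (forall u v a b a' b', col (a, b) = col (a', b') ->
     #|[set c | (col (a, c) == u) && (col (c, b) == v)]|
     = #|[set c | (col (a', c) == u) && (col (c, b') == v)]|) ->
  coherent (preim_partition col setT).
Proof.
move=> hd hi hc; have pS := preim_partitionP col setT.
have colP r : r \in preim_partition col setT -> exists p, r = [set q | col q == col p].
  by case/imsetP=> p _ ->; exists p; apply/setP=> q; rewrite !inE eq_sym.
split=> //.
- apply/(is_unionP pS) => -[a b] [c d] /preim_classP e /imsetP[x _ [ax bx]].
  move: e; rewrite ax bx => /hd->; apply: imset_f; exact: in_setT.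
- move=> s /colP[[a b] ->]; apply/imsetP; exists (b, a) => //.
  apply/setP=> -[c d]; rewrite !inE; apply/imsetP/eqP=> [[[x y]]|e].
    by rewrite inE /= => /eqP/hi e [-> ->].
  by exists (d, c) => //; rewrite inE; apply/eqP/hi.
- move=> r s t /colP[p ->] /colP[q ->] /colP[w ->] a b a' b'; rewrite !inE => /eqP e /eqP e'.
  have := hc (col p) (col q) a b a' b'; rewrite e e' => /(_ erefl).
  by congr (_ = _); apply: eq_card => c; rewrite !inE.
Qed.

End Colouring.

(** * Generalized bases tested on all fissions *)

Section GenBase.
Variables (T : finType) (S : {set {set T * T}}) (Pi : {set {set T}}).

(** The witness is the discrete configuration, the level sets of the identity. It is the smallest
    admissible fission because every admissible fission is complete. *)
Lemma gen_baseI :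
  (forall S', coherent S' -> finer S S' -> (forall X, X \in Pi -> union_of_fibers S' X) ->
     cc_complete S') -> gen_base S Pi.
Proof.
move=> H; exists (preim_partition id setT).
have pS := preim_partitionP (@id (T * T)) setT.
have clsE p q : pblock (preim_partition (@id (T * T)) setT) p
    = pblock (preim_partition id setT) q -> p = q by move/preim_classP.
have cD : coherent (preim_partition (@id (T * T)) setT).
  apply: coherent_colouring => [a b c [-> ->] //|a b a' b' [-> -> //]|].
  by move=> u v a b a' b' [-> ->].
split; last exact: completeI.
split=> [|X XPi|S' [cS' fS'] uS'].
- by split=> //; apply: finerI => // r p q _ /clsE->.
- by apply/union_of_fibersP => // x y /clsE[->].
have pS' := coherent_partition cS'.
have cplS := completeE pS' (H _ cS' fS' uS').
by move=> r _; apply/is_unionP => // p q /cplS->.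
Qed.

(** By minimality [S'] refines the [Pi]-fission, whose classes are already single pairs. *)
Lemma gen_baseE S' : gen_base S Pi -> coherent S' -> finer S S' ->
  (forall X, X \in Pi -> union_of_fibers S' X) -> cc_complete S'.
Proof.
move=> [S0 [[[cS0 _] _ minS0] cpl]] cS' fS' uS'.
have {minS0}fin := minS0 S' (conj cS' fS') uS'.
have pS' := coherent_partition cS'; have pS0 := coherent_partition cS0.
apply: completeI => // p q e.
have := finerE pS' fin (class_in pS0 p) e (mem_class pS0 p).
by move/(class_eq pS0 (class_in pS0 p))=> /(completeE pS0 cpl).
Qed.

End GenBase.

(** * Quotient of a union of fibers by an invariant equivalence *)

Section Quotient.
Variables (T U : finType) (S : {set {set T * T}}) (D : pred T) (f : T -> U).
Hypothesis cS : coherent S.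
Hypothesis hD : forall a a', pblock S (a, a) = pblock S (a', a') -> D a -> D a'.
Hypothesis hf : forall a b a' b', D a -> D b -> D a' -> D b' ->
  pblock S (a, b) = pblock S (a', b') -> f a = f b -> f a' = f b'.
Hypothesis f_onto : forall u, exists2 a, D a & f a = u.

(** The blocks of the equivalence are the level sets of [f] on [D]; a pair of blocks is coloured by
    all classes occurring between them. *)
Definition qcol (x : U * U) : {set {set T * T}} :=
  [set pblock S p | p in [set p | [&& D p.1, D p.2, f p.1 == x.1 & f p.2 == x.2]]].

Definition quotient_config := preim_partition qcol setT.

Lemma qcolP s x y :
  reflect (exists a b, [/\ D a, D b, f a = x, f b = y & s = pblock S (a, b)])
          (s \in qcol (x, y)).
Proof.
apply: (iffP imsetP) => [[[a b]]|[a [b [Da Db <- <- ->]]]].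
  by rewrite inE /= => /and4P[Da Db /eqP<- /eqP<-] ->; exists a, b.
by exists (a, b); rewrite // inE /= Da Db !eqxx.
Qed.

(** Two transports move a pair between the first two blocks to one between the other two: first its
    left end, then its right end. *)
Lemma qcol_eq a b a' b' : D a -> D b -> D a' -> D b' ->
  pblock S (a, b) = pblock S (a', b') -> qcol (f a, f b) = qcol (f a', f b').
Proof.
have sub x y x' y' : D x -> D y -> D x' -> D y' ->
    pblock S (x, y) = pblock S (x', y') -> qcol (f x, f y) \subset qcol (f x', f y').
  move=> Dx Dy Dx' Dy' e; apply/subsetP=> s /qcolP[c [d [Dc Dd fc fd ->]]].
  have [c' [xc cy]] := class_transport cS c e.
  have Dc' : D c' by apply: hD (class_snd cS xc) Dc.
  have [d' [cd dy]] := class_transport cS d cy.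
  have Dd' : D d' by apply: hD (class_snd cS cd) Dd.
  apply/qcolP; exists c', d'; split=> //.
    by apply/esym; apply: (hf _ _ _ _ xc).
  by apply: (hf _ _ _ _ dy).
by move=> Da Db Da' Db' e; apply/eqP; rewrite eqEsubset !sub.
Qed.

Lemma qcol_lift a b x y : D a -> D b -> qcol (f a, f b) = qcol (x, y) ->
  exists a' b', [/\ D a', D b', f a' = x, f b' = y & pblock S (a, b) = pblock S (a', b')].
Proof.
move=> Da Db e; apply/qcolP; rewrite -e; apply/qcolP.
by exists a, b.
Qed.

Lemma quotient_config_lift a b x y : D a -> D b ->
  pblock quotient_config (f a, f b) = pblock quotient_config (x, y) ->
  exists a' b', [/\ D a', D b', f a' = x, f b' = y & pblock S (a, b) = pblock S (a', b')].
Proof. by move=> Da Db /preim_classP; apply: qcol_lift. Qed.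

Lemma quotient_config_class a b a' b' : D a -> D b -> D a' -> D b' ->
  pblock S (a, b) = pblock S (a', b') ->
  pblock quotient_config (f a, f b) = pblock quotient_config (f a', f b').
Proof. by move=> *; apply/preim_classP; apply: qcol_eq. Qed.

(** Paths are counted upstairs. Each midpoint [z] of a path below contributes its block size [n z];
    this size is common to all midpoints involved and can be cancelled. *)
Lemma coherent_quotient_config : coherent quotient_config.
Proof.
have iD a b a' b' : pblock S (a, b) = pblock S (a', b') ->
    (D a = D a') * (D b = D b').
  move=> e; have ea := class_fst cS e; have eb := class_snd cS e.
  by split; apply/idP/idP; apply: hD.
apply: coherent_colouring.
- move=> x y z; have [a Da <-] := f_onto x.
  by case/(qcol_lift Da Da)=> b [c [_ _ <- <-]] /(class_diag cS)->.
- move=> x y x' y'; have [a Da <-] := f_onto x; have [b Db <-] := f_onto y.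
  by case/(qcol_lift Da Db)=> a' [b' [Da' Db' <- <-]] /(class_inv cS); apply: qcol_eq.
move=> u v x y x' y'; have [a Da <-] := f_onto x; have [b Db <-] := f_onto y.
case/(qcol_lift Da Db)=> a' [b' [Da' Db' <- <-]] e.
pose P c d := [&& D c, D d & qcol (f c, f d) == u].
pose Q c d := [&& D c, D d & qcol (f c, f d) == v].
have inv w : class_invariant S (fun c d => [&& D c, D d & qcol (f c, f d) == w]).
  move=> c d c' d' cd; rewrite -!(iD _ _ _ _ cd).
  case Dc: (D c) => //=; case Dd: (D d) => //=.
  by rewrite (qcol_eq _ _ _ _ cd) // -(iD _ _ _ _ cd).
have iF : class_invariant S (fun c d => [&& D c, D d & f c == f d]).
  move=> c d c' d' cd; rewrite -!(iD _ _ _ _ cd).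
  case Dc: (D c) => //=; case Dd: (D d) => //=.
  have [Dc' Dd'] : D c' /\ D d' by rewrite -!(iD _ _ _ _ cd).
  by apply/eqP/eqP; [apply: hf cd | apply: hf (esym cd)].
pose n z := #|[set c | D c && (f c == z)]|.
have count s t : D s -> D t -> #|[set c | P s c && Q c t]|
    = \sum_(z in [set z | (qcol (f s, z) == u) && (qcol (z, f t) == v)]) n z.
  move=> Ds Dt; rewrite -sum1_card (partition_big f
    (mem [set z | (qcol (f s, z) == u) && (qcol (z, f t) == v)])) /=; last first.
    by move=> c; rewrite inE => /andP[/and3P[_ _ cu] /and3P[_ _ cv]]; rewrite inE cu.
  apply: eq_bigr => z; rewrite inE => /andP[zu zv]; rewrite /n -sum1_card.
  apply: eq_bigl => c; rewrite !inE /P /Q Ds Dt /=.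
  by case Dc: (D c) => //=; have [->|_] := eqVneq (f c) z; rewrite ?zu ?zv ?andbF.
(* A block size is a path count from a lift [c] back to itself, so it depends only on the fiber of
   [c]. *)
have nE z z' : qcol (f a, z) = qcol (f a', z') -> n z = n z'.
  have [c Dc <-] := f_onto z => /(qcol_lift Da Dc)[a2 [c' [_ Dc' _ <-]]].
  move/(class_snd cS)=> ec.
  have := card_path_class cS iF iF ec; congr (_ = _); apply: eq_card => d; rewrite !inE.
    by rewrite Dc /=; case: (D d) => //=; rewrite ?andbT ![f d == _]eq_sym andbb.
  by rewrite Dc' /=; case: (D d) => //=; rewrite ?andbT ![f d == _]eq_sym andbb.
have := card_path_class cS (inv u) (inv v) e.
rewrite -/(P _) (count a b) // (count a' b') //.
set Z := [set z | _]; set Z' := [set z | _] => EZ.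
have nZ z z' : z \in Z -> z' \in Z' -> n z = n z'.
  by rewrite !inE => /andP[/eqP h _] /andP[/eqP h' _]; apply: nE; rewrite h h'.
have n_gt0 z : 0 < n z.
  by have [c Dc <-] := f_onto z; apply/card_gt0P; exists c; rewrite inE Dc eqxx.
(* An empty [Z] or [Z'] offers no common value of [n] to cancel; there the positivity of [n]
   decides. *)
have [Z0|/set0Pn[z zZ]] := eqVneq Z set0.
  have [-> |/set0Pn[z zZ']] := eqVneq Z' set0; first by rewrite Z0.
  move: EZ; rewrite Z0 big_set0 (bigD1 z) //= => /esym/eqP.
  by rewrite addn_eq0 eqn0Ngt n_gt0.
have [Z0|/set0Pn[z' zZ']] := eqVneq Z' set0.
  move: EZ; rewrite Z0 big_set0 (bigD1 z) //= => /eqP.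
  by rewrite addn_eq0 eqn0Ngt n_gt0.
apply/eqP; rewrite -(eqn_pmul2r (n_gt0 z)); apply/eqP.
rewrite -!sum_nat_const; rewrite (eq_bigr n) ?EZ; last first.
  by move=> w wZ; rewrite (nZ w z') // (nZ z z').
by apply: eq_bigr => w wZ; rewrite (nZ z w).
Qed.

End Quotient.

(** * Hamming distance on [G^m] and its lines *)

Section Hamming.
Variables (G : finType) (m : nat).
Local Notation pt := {ffun 'I_m -> G}.
Implicit Types (a b c x : pt) (i j : 'I_m) (g h : G).

Definition ham a b := #|[set i | a i != b i]|.
Definition upd a i g : pt := [ffun j => if j == i then g else a j].

Lemma upd_same a i g : upd a i g i = g. Proof. by rewrite ffunE eqxx. Qed.

Lemma upd_other a i g j : j != i -> upd a i g j = a j.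
Proof. by rewrite ffunE => /negPf->. Qed.

Lemma upd_id a i : upd a i (a i) = a.
Proof. by apply/ffunP=> j; rewrite ffunE; case: eqP => [->|]. Qed.

Lemma upd_upd a i g h : upd (upd a i g) i h = upd a i h.
Proof. by apply/ffunP=> j; rewrite !ffunE; case: eqP. Qed.

Lemma ham_sym a b : ham a b = ham b a.
Proof. by apply: eq_card => i; rewrite !inE eq_sym. Qed.

Lemma ham_refl a : ham a a = 0.
Proof. by apply/eqP; rewrite cards_eq0; apply/eqP/setP=> i; rewrite !inE eqxx. Qed.

Lemma ham_upd a i g : ham a (upd a i g) = (g != a i).
Proof.
case: (eqVneq g (a i)) => [->|ne]; first by rewrite upd_id ham_refl.
apply/eqP/cards1P; exists i; apply/setP=> j; rewrite !inE.
by case: (eqVneq j i) => [->|h]; rewrite ?upd_same ?upd_other ?eqxx // eq_sym.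
Qed.

Lemma ham_upd2 a i g h : ham (upd a i g) (upd a i h) = (g != h).
Proof. by rewrite -(upd_upd a i g h) ham_upd upd_same eq_sym. Qed.

Lemma ham1 a b : ham a b = 1 -> exists i g, g != a i /\ b = upd a i g.
Proof.
move/eqP/cards1P=> [i /setP E]; exists i, (b i).
have /[!inE] := E i; rewrite eqxx eq_sym => ->; split=> //.
apply/ffunP=> j; rewrite ffunE; have /[!inE] := E j.
by case: (eqVneq j i) => [->|_ /negbT/negPn/eqP].
Qed.

Lemma ham_le1 a b i : ham a b <= 1 -> a i != b i -> b = upd a i (b i).
Proof.
move=> le1 ne; have i_in : i \in [set i | a i != b i] by rewrite inE.
have /eqP/ham1[j [g [_ bE]]] : ham a b == 1.
  by rewrite eqn_leq le1; apply/card_gt0P; exists i.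
move: ne; rewrite bE; have [->|nij] := eqVneq i j; first by rewrite upd_same.
by rewrite upd_other ?eqxx.
Qed.

(** The coordinate [c i] differs from that of at least one end of the edge, and [c] can differ from
    that end nowhere else. *)
Lemma on_line a i g c : g != a i -> ham a c <= 1 -> ham c (upd a i g) <= 1 ->
  c = upd a i (c i).
Proof.
move=> ga ac cb; have [ci|ci] := eqVneq (c i) (a i); last first.
  by rewrite eq_sym in ci; apply: ham_le1.
have E : upd a i g = upd c i g.
  by rewrite (ham_le1 cb (i := i)) ?upd_same // ci eq_sym.
by rewrite -(upd_upd a i g) E upd_upd upd_id.
Qed.

Lemma ham_split a b i : ham a b = (a i != b i) + #|[set j | (j != i) && (a j != b j)]|.
Proof. by rewrite /ham (cardsD1 i) inE; congr (_ + _); apply: eq_card => j; rewrite !inE. Qed.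

(** Both sides are sums, which avoids truncated subtraction. *)
Lemma ham_upd_r a b i g : ham a b + (a i != g) = ham a (upd b i g) + (a i != b i).
Proof.
rewrite !(ham_split _ _ i) upd_same addnC [RHS]addnC addnCA.
do 2!congr (_ + _); apply: eq_card => j; rewrite !inE.
by case: (eqVneq j i) => //= nj; rewrite upd_other.
Qed.

End Hamming.

(** * Edges, lines and marks in a fission of the exponentiation *)

Section Exponentiation.
Variables (G : finType) (m : nat) (S : {set {set G * G}}) (L : {group {perm 'I_m}}).
Local Notation pt := {ffun 'I_m -> G}.
Variable W : {set {set pt * pt}}.
Hypotheses (cS : coherent S) (cW : coherent W) (fW : finer (expo S L) W).
Implicit Types (a b c x : pt) (i j : 'I_m) (g h : G).
Local Notation wc a b := (pblock W (a, b)).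
Local Notation sc g h := (pblock S (g, h)).

Let pS := coherent_partition cS.
Let pW := coherent_partition cW.

Lemma expo_class a b a' b' : wc a b = wc a' b' ->
  exists2 l, l \in L & forall i, sc (a i) (b i) = sc (a' (l i)) (b' (l i)).
Proof.
move=> e; pose f := [ffun i => sc (a i) (b i)].
have rE : \bigcup_(l in L) rel_act l (tensor f) \in expo S L.
  by apply: imset_f; rewrite inE; apply/forallP=> i; rewrite ffunE class_in.
have abr : (a, b) \in \bigcup_(l in L) rel_act l (tensor f).
  apply/bigcupP; exists 1%g => //; apply/imsetP; exists (a, b) => /=.
    by rewrite inE; apply/forallP=> i; rewrite ffunE mem_class.
  by congr (_, _); apply/ffunP=> i; rewrite ffunE invg1 perm1.
have /bigcupP[l lL /imsetP[[p q]]] := finerE pW fW rE e abr.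
rewrite inE => /forallP pq [-> ->]; exists l => // i.
have:= pq i; rewrite !ffunE /= permK => h.
by rewrite (class_eq pS (class_in pS _) h).
Qed.

Lemma ham_class a b a' b' : wc a b = wc a' b' -> ham a b = ham a' b'.
Proof.
case/expo_class=> l _ le; rewrite /ham -(card_imset _ (@perm_inj _ l)).
apply: eq_card => i; rewrite inE -{2 3}(permKV l i).
rewrite -(class_eq_pt cS (le _)).
rewrite -{1}(permKV l i) mem_imset ?inE //; exact: perm_inj.
Qed.

(** The coordinate permutation must send [i] to [i'], since an edge is constant in all directions
    but its own. *)
Lemma edge_class a i g a' i' g' : g != a i -> g' != a' i' ->
  wc a (upd a i g) = wc a' (upd a' i' g') -> sc (a i) g = sc (a' i') g'.
Proof.
move=> ga ga' /expo_class[l _ /(_ i)]; rewrite upd_same => le.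
have li : l i = i'.
  apply/eqP; apply: contraNT ga => li; rewrite eq_sym.
  by rewrite (class_eq_pt cS le) upd_other ?eqxx.
by rewrite le li upd_same.
Qed.

Lemma line_transport a i g a' i' g' h : g != a i -> g' != a' i' ->
  wc a (upd a i g) = wc a' (upd a' i' g') ->
  exists h', wc a (upd a i h) = wc a' (upd a' i' h') /\
    wc (upd a i h) (upd a i g) = wc (upd a' i' h') (upd a' i' g').
Proof.
move=> ga ga' e; have [c [ac cb]] := class_transport cW (upd a i h) e.
exists (c i'); rewrite -(@on_line _ _ a' i' g' c) //.
  by rewrite -(ham_class ac) ham_upd; case: (_ != _).
by rewrite -(ham_class cb) ham_upd2; case: (_ != _).
Qed.

(** The new edge starts at the point with coordinate [h] and aims at the old far end; if that is the
    point itself, the old edge is reversed. *)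
Lemma edge_rebase a i g a' i' g' h : g != a i -> g' != a' i' ->
  wc a (upd a i g) = wc a' (upd a' i' g') ->
  exists h' k k', [/\ k != h, k' != h' &
    wc (upd a i h) (upd (upd a i h) i k) = wc (upd a' i' h') (upd (upd a' i' h') i' k')].
Proof.
move=> ga ga' e; have [hg|hg] := eqVneq h g.
  exists g', (a i), (a' i'); rewrite hg eq_sym ga eq_sym ga'; split=> //.
  by rewrite !upd_upd !upd_id; apply: class_inv e.
have [h' [_ e']] := line_transport h ga ga' e; exists h', g, g'.
rewrite eq_sym hg !upd_upd; split=> //; apply: contraNneq hg => E.
by move: e'; rewrite E => /ham_class; rewrite !ham_upd2 eqxx; case: eqP.
Qed.

(** This is the precise meaning of being marked: [P] at the start of an edge can be read off the
    class of the edge. If [P] ignores the value it marks a set of coordinates; if it ignores the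
    direction, a subset of [G]. *)
Definition edge_inv (P : 'I_m -> pred G) := forall a i g a' i' g',
  g != a i -> g' != a' i' -> wc a (upd a i g) = wc a' (upd a' i' g') ->
  P i (a i) = P i' (a' i').

Lemma edge_invW (P : 'I_m -> pred G) :
  (forall a i g a' i' g', g != a i -> g' != a' i' ->
     wc a (upd a i g) = wc a' (upd a' i' g') -> P i (a i) -> P i' (a' i')) ->
  edge_inv P.
Proof.
move=> H a i g a' i' g' ga ga' e; apply/idP/idP; first exact: H e.
by apply: H (esym e).
Qed.

Lemma edge_inv_ext P Q : (forall i g, P i g = Q i g) -> edge_inv P -> edge_inv Q.
Proof. by move=> E H a i g a' i' g' ga ga' e; rewrite -!E; apply: H e. Qed.

Lemma edge_invN P : edge_inv P -> edge_inv (fun i g => ~~ P i g).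
Proof. by move=> H a i g a' i' g' ga ga' e; rewrite (H _ _ _ _ _ _ ga ga' e). Qed.

Lemma edge_invI P Q : edge_inv P -> edge_inv Q -> edge_inv (fun i g => P i g && Q i g).
Proof.
move=> HP HQ a i g a' i' g' ga ga' e.
by rewrite (HP _ _ _ _ _ _ ga ga' e) (HQ _ _ _ _ _ _ ga ga' e).
Qed.

Lemma edge_invU P Q : edge_inv P -> edge_inv Q -> edge_inv (fun i g => P i g || Q i g).
Proof.
move=> HP HQ a i g a' i' g' ga ga' e.
by rewrite (HP _ _ _ _ _ _ ga ga' e) (HQ _ _ _ _ _ _ ga ga' e).
Qed.

Lemma edge_inv_exists P : edge_inv P -> edge_inv (fun i _ => [exists g, P i g]).
Proof.
move=> HP; apply: edge_invW => a i g a' i' g' ga ga' e /existsP[h Ph].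
have [h' [k [k' [kh kh' e']]]] := edge_rebase h ga ga' e.
apply/existsP; exists h'; have := HP _ _ _ _ _ _ _ _ e'.
by rewrite !upd_same => <-.
Qed.

Definition fiber_inv (X : pred pt) :=
  forall x y, wc x x = wc y y -> X x -> X y.

(* On a line in direction [i] the points whose [i]-th coordinate lies in [X i] are
   exactly those nearest to the product set. *)
Lemma edge_inv_prod (X : 'I_m -> {set G}) : (forall i, X i != set0) ->
  fiber_inv (fun x => [forall i, x i \in X i]) -> edge_inv (fun i g => g \in X i).
Proof.
move=> X0 fX; pose dist a := #|[set i | a i \notin X i]|.
(* Correcting only the bad coordinates shows that [dist] is the distance to the product set. The
   default [a i] is never reached, as [X i] is nonempty. *)
have near a : exists2 c : pt, [forall i, c i \in X i] & ham a c = dist a.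
  pose c : pt := [ffun i => if a i \in X i then a i else odflt (a i) [pick g in X i]].
  have cX i : c i \in X i.
    rewrite ffunE; case: ifP => // _; case: pickP => //= h.
    by have /set0Pn[g] := X0 i; rewrite h.
  exists c; first exact/forallP.
  apply: eq_card => i; rewrite !inE; have := cX i; rewrite ffunE.
  by case: ifP => [_ _|ai]; [rewrite eqxx | apply: contraTneq => <-; rewrite ai].
have dist_le a (c : pt) : [forall i, c i \in X i] -> dist a <= ham a c.
  move/forallP=> cX; apply: subset_leq_card; apply/subsetP=> i; rewrite !inE.
  by apply: contraNneq => ->.
have distP a a' : wc a a = wc a' a' -> dist a' <= dist a.
  move=> e; have [c cX <-] := near a; have [c' [ac _]] := class_transport cW c e.
  by rewrite (ham_class ac); apply: dist_le; apply: fX (class_snd cW ac) cX.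
have dist_split a i : dist a = (a i \notin X i) + #|[set j | (j != i) && (a j \notin X j)]|.
  by rewrite /dist (cardsD1 i) inE; congr (_ + _); apply: eq_card => j; rewrite !inE.
have dist_upd a i h : dist (upd a i h) = (h \notin X i) + #|[set j | (j != i) && (a j \notin X j)]|.
  rewrite (dist_split _ i) upd_same; congr (_ + _); apply: eq_card => j; rewrite !inE.
  by case: eqP => //= /eqP ji; rewrite upd_other.
(* If [a'] were outside, a point of its line would be strictly nearer to the product set, while no
   point of the line of [a] is nearer than [a]. *)
apply: edge_invW => a i g a' i' g' ga ga' e ai; apply: contraT => ai'.
have /set0Pn[h' hX'] := X0 i'.
have [h [ac _]] := line_transport h' ga' ga (esym e).
have := distP _ _ (class_fst cW e).
have := distP _ _ (class_snd cW ac).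
rewrite !dist_upd (dist_split a i) (dist_split a' i') ai ai' hX' /= add0n => h1 h2.
by have := leq_trans h2 (leq_trans (leq_addl _ _) h1); rewrite ltnn.
Qed.

Lemma edge_inv_pt x : fiber_inv (pred1 x) -> edge_inv (fun i g => g == x i).
Proof.
move=> fx; apply: (@edge_inv_ext (fun i g => g \in [set x i])).
  by move=> i g; rewrite inE.
apply: edge_inv_prod => [i|y z e].
  by apply/set0Pn; exists (x i); rewrite inE.
have E (w : pt) : [forall i, w i \in [set x i]] = (w == x).
  apply/forallP/eqP=> [h|-> i]; last by rewrite inE.
  by apply/ffunP=> i; apply/set1P.
by rewrite !E; apply: fx.
Qed.

End Exponentiation.

(** * Completeness from marked coordinates and a marked generalized base *)

Section Completeness.
Variables (G : finType) (m : nat) (S : {set {set G * G}}) (L : {group {perm 'I_m}}).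
Local Notation pt := {ffun 'I_m -> G}.
Variable W : {set {set pt * pt}}.
Hypotheses (cS : coherent S) (cW : coherent W) (fW : finer (expo S L) W).
Implicit Types (a b c x : pt) (i j : 'I_m) (g h : G).
Local Notation wc a b := (pblock W (a, b)).
Local Notation sc g h := (pblock S (g, h)).

Hypothesis G_gt1 : 1 < #|G|.

Lemma exists_neq g : exists h, h != g.
Proof.
have : 0 < #|[set~ g]| by rewrite cardsC1; case: #|G| G_gt1 => [|[]].
by case/card_gt0P=> h; rewrite !inE; exists h.
Qed.

Hypothesis coord_inv : forall i, edge_inv W (fun j _ => j == i).

Lemma coord_eq a i g a' i' g' : g != a i -> g' != a' i' ->
  wc a (upd a i g) = wc a' (upd a' i' g') -> i = i'.
Proof. by move=> ga ga' e; apply/eqP; rewrite (coord_inv i' ga ga' e) eqxx. Qed.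

(** Stepping from [a] in direction [i] to the value [b i] shortens the distance to [b] by one. The
    copied step has the same direction and the same gain, so it must reach the value [b' i]. *)
Lemma diff_coord_class a b a' b' i : wc a b = wc a' b' -> a i != b i ->
  a' i != b' i /\ sc (a i) (b i) = sc (a' i) (b' i).
Proof.
move=> e ne; have [c' [ac cb]] := class_transport cW (upd a i (b i)) e.
have bai : b i != a i by rewrite eq_sym.
have [i' [g' [ga' c'E]]] : exists i' g', g' != a' i' /\ c' = upd a' i' g'.
  by apply: ham1; rewrite -(ham_class cS cW fW ac) ham_upd bai.
rewrite c'E in ac cb; have ii' := coord_eq bai ga' ac; move: ga' ac cb; rewrite -ii'.
move=> ga' ac cb; rewrite (edge_class cS cW fW bai ga' ac).
have := ham_upd_r b' a' i g'; have := ham_upd_r b a i (b i).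
rewrite -[ham b (upd _ _ _)]ham_sym -[ham b' (upd _ _ _)]ham_sym.
rewrite (ham_class cS cW fW cb) ![ham _ a]ham_sym ![ham _ a']ham_sym.
rewrite (ham_class cS cW fW e) eqxx bai addn0 => ->; rewrite -addnA => /addnI.
have [->|_] := eqVneq (b' i) g'; last by case: (_ != _).
by rewrite [a' i == _]eq_sym; case: (_ != _).
Qed.

Lemma coord_class a b a' b' i : wc a b = wc a' b' ->
  (a i == b i) = (a' i == b' i) /\ sc (a i) (b i) = sc (a' i) (b' i).
Proof.
move=> e; have [ab|ab] := eqVneq (a i) (b i); last first.
  by have [/negPf-> ->] := diff_coord_class e ab.
have [ab'|ab'] := eqVneq (a' i) (b' i); last first.
  by have [] := diff_coord_class (esym e) ab'; rewrite ab eqxx.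
(* With equal coordinates only the fiber of [a i] is at stake; it is read off any edge leaving [a]
   in direction [i]. *)
split=> //; rewrite -ab -ab'; have [g ga] := exists_neq (a i).
have [c' [ac _]] := class_transport cW (upd a i g) (class_fst cW e).
have := @diff_coord_class _ _ _ _ i ac; rewrite upd_same eq_sym => /(_ ga)[_].
exact: class_fst.
Qed.

(** The quotient is taken on all of [G^m] by the value at [i]. Its fibers respect [X] in [Pi]
    because an edge in direction [i] at a lift reveals membership in [X]. *)
Lemma complete_of_coord_inv (Pi : {set {set G}}) :
  gen_base S Pi -> (forall X, X \in Pi -> edge_inv W (fun _ g => g \in X)) ->
  cc_complete W.
Proof.
move=> bPi hPi; have pW := coherent_partition cW; have pS := coherent_partition cS.
suff H a b a' b' i : wc a b = wc a' b' -> a i = a' i.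
  apply: completeI => // -[a b] [a' b'] e; congr (_, _); apply/ffunP=> i.
    exact: H e.
  exact: H (class_inv cW e).
pose f a : G := a i; pose D := @predT pt.
have hD a1 a1' : wc a1 a1 = wc a1' a1' -> D a1 -> D a1' by [].
have hf a1 b1 a1' b1' : D a1 -> D b1 -> D a1' -> D b1' ->
    wc a1 b1 = wc a1' b1' -> f a1 = f b1 -> f a1' = f b1'.
  by move=> _ _ _ _ /(@coord_class _ _ _ _ i)[+ _] /eqP h; rewrite [_ == _]h => /esym/eqP.
have onto u : exists2 a1, D a1 & f a1 = u by exists [ffun=> u]; rewrite // /f ffunE.
have cQ := coherent_quotient_config cW hD hf onto.
have pQ := coherent_partition cQ.
have liftQ (x y x' y' : G) : pblock (quotient_config W D f) (x, y) =
    pblock (quotient_config W D f) (x', y') ->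
    exists a1 b1 a1' b1', [/\ a1 i = x, b1 i = y, a1' i = x', b1' i = y' & wc a1 b1 = wc a1' b1'].
  have [a1 _ <-] := onto x; have [b1 _ <-] := onto y.
  by case/quotient_config_lift=> // a1' [b1' [_ _ <- <- e]]; exists a1, b1, a1', b1'.
have cplQ : cc_complete (quotient_config W D f).
  apply: (gen_baseE bPi cQ) => [|X XPi].
    apply: finerI => // r [x y] [x' y'] rS.
    case/liftQ=> a1 [b1 [a1' [b1' [<- <- <- <- /(@coord_class _ _ _ _ i)[_ e]]]]].
    exact: class_ind e.
  apply/(union_of_fibersP cQ) => x y /liftQ[a1 [b1 [a1' [b1' [<- _ <- _ /(class_fst cW) e]]]]].
  have [g ga] := exists_neq (a1 i).
  have [c' [ac _]] := class_transport cW (upd a1 i g) e.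
  have [i' [g' [ga' c'E]]] : exists i' g', g' != a1' i' /\ c' = upd a1' i' g'.
    by apply: ham1; rewrite -(ham_class cS cW fW ac) ham_upd ga.
  rewrite c'E in ac; have ii' := coord_eq ga ga' ac; subst i'.
  by rewrite (hPi _ XPi _ _ _ _ _ _ ga ga' ac).
move=> e; suff /(completeE pQ cplQ)[] : pblock (quotient_config W D f) (a i, b i)
    = pblock (quotient_config W D f) (a' i, b' i) by [].
exact: (@quotient_config_class _ _ _ D f cW hD hf).
Qed.

End Completeness.

Lemma ham_upd_distinct (G : finType) m (a : {ffun 'I_m -> G}) i j g h :
  i != j -> g != a i -> h != a j -> ham (upd a i g) (upd a j h) = 2.
Proof.
move=> ij ga ha; apply/eqP/cards2P; exists i, j; split=> //.
apply/setP=> k; rewrite !inE.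
have [->|ki] := eqVneq k i; first by rewrite upd_same upd_other ?ga.
rewrite (upd_other _ _ ki); have [->|kj] := eqVneq k j; first by rewrite upd_same eq_sym.
by rewrite upd_other ?eqxx.
Qed.

Lemma card_ord_lt m k : k <= m -> #|[set i : 'I_m | i < k]| = k.
Proof. by move=> km; rewrite -sum1dep_card (big_ord_narrow km) sum1_card card_ord. Qed.

(** * The staircase and the coordinates that it marks *)

Section Staircase.
Variables (G : finType) (m : nat) (S : {set {set G * G}}) (L : {group {perm 'I_m}}).
Local Notation pt := {ffun 'I_m -> G}.
Variables (Delta : {set G}) (q : G).

Definition step (k : nat) (i : 'I_m) : {set G} := if i < k then Delta else [set q].
Definition staircase : {set pt} :=
  [set x : pt | [exists k : 'I_m.+1, [forall i, x i \in step k i]]].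

Variable W : {set {set pt * pt}}.
Hypotheses (cS : coherent S) (cW : coherent W) (fW : finer (expo S L) W).
Implicit Types (a b c x y : pt) (i j : 'I_m) (g h : G).
Local Notation wc a b := (pblock W (a, b)).
Local Notation sc g h := (pblock S (g, h)).

Hypothesis m_gt1 : 1 < m.
Hypothesis qDelta : q \notin Delta.
Hypothesis Delta0 : Delta != set0.
Hypothesis qP : (forall g, sc g g = sc q q -> g = q) \/ 1 < #|Delta|.
Hypothesis uX : union_of_fibers W staircase.

Let u : pt := [ffun=> q].

Lemma staircaseP x :
  reflect (exists2 k, k <= m & forall i, x i \in step k i) (x \in staircase).
Proof.
rewrite inE; apply: (iffP existsP) => [[k /forallP H]|[k km H]].
  by exists k; rewrite // -ltnS.
by exists (Ordinal (km : k < m.+1)); apply/forallP.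
Qed.

Lemma ham_step k x : k <= m -> (forall i, x i \in step k i) -> ham u x = k.
Proof.
move=> km H; rewrite -[RHS](card_ord_lt km); apply: eq_card => i; rewrite !inE ffunE.
have := H i; rewrite /step; case: ifP => _; last by rewrite inE eq_sym => ->.
by apply: contraTN => /eqP<-.
Qed.

Lemma stepE k x : k <= m ->
  [forall i, x i \in step k i] = (x \in staircase) && (ham u x == k).
Proof.
move=> km; apply/forallP/andP=> [H|[/staircaseP[k' km' H]]].
  by rewrite (ham_step km H); split=> //; apply/staircaseP; exists k.
by rewrite (ham_step km' H) => /eqP<-.
Qed.

Let staircase_class x y : wc x x = wc y y -> x \in staircase -> y \in staircase.
Proof. exact: ((union_of_fibersP cW _).1 uX). Qed.

(** In piece [k > 0], coordinate 0 can be changed inside [Delta]. A second direction is coordinate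
    [k], which leads to piece [k + 1], or coordinate 1 when [k = m]. *)
Lemma branching x : x \in staircase -> x != u -> 1 < #|Delta| ->
  exists y z, [/\ y \in staircase, z \in staircase, ham x y = 1, ham x z = 1 & ham z y = 2].
Proof.
move=> /staircaseP[k km xk] xu D2.
have k_gt0 : 0 < k.
  rewrite -(ham_step km xk) card_gt0; apply: contraNneq xu => /setP E.
  by apply/eqP/ffunP=> i; have /[!inE] /negbT/negPn/eqP := E i.
have other g : exists2 h, h \in Delta & h != g.
  have : 0 < #|Delta :\ g|.
    by move: D2; rewrite (cardsD1 g Delta); case: (_ \in _); rewrite ?add1n // => /ltnW.
  by case/card_gt0P=> h /setD1P[]; exists h.
have ext j : j < k \/ j = k :> nat ->
    exists2 h, h != x j & upd x j h \in staircase.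
  case=> [jk|jk].
    have [h hD hx] := other (x j); exists h => //; apply/staircaseP; exists k => // i.
    have [->|ij] := eqVneq i j; first by rewrite upd_same /step jk.
    by rewrite upd_other.
  have /set0Pn[h hD] := Delta0; exists h.
    have := xk j; rewrite /step jk ltnn inE => /eqP->.
    by apply: contraNneq qDelta => <-.
  apply/staircaseP; exists k.+1 => [|i]; first by rewrite -jk.
  have [->|ij] := eqVneq i j; first by rewrite upd_same /step jk ltnS leqnn.
  have ik : (i == k :> nat) = false by rewrite -jk val_eqE; apply: negPf.
  by rewrite upd_other // /step ltnS leq_eqVlt ik; apply: xk.
pose i0 := Ordinal (ltnW m_gt1).
have [i1 i1k i01] : exists2 i1 : 'I_m, i1 < k \/ i1 = k :> nat & i1 != i0.
  have [km'|mk] := ltnP k m.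
    by exists (Ordinal km'); [right | rewrite -(inj_eq val_inj) -lt0n].
  by exists (Ordinal m_gt1) => //; left; apply: leq_trans mk.
have [g gx gX] := ext i0 (or_introl k_gt0); have [h hx hX] := ext i1 i1k.
exists (upd x i0 g), (upd x i1 h); rewrite !ham_upd gx hx; split=> //.
exact: ham_upd_distinct.
Qed.

(* [u] is the only point of the staircase whose neighbours in it are pairwise adjacent. *)
Lemma staircase_origin : fiber_inv W (pred1 u).
Proof.
(* If [q] is alone in its fiber, the class of [(u, u)] already determines every coordinate. *)
move=> x y e /eqP xu; case: qP => [qfib|D2]; apply/eqP.
  rewrite xu in e; have [l _ le] := expo_class cS cW fW e.
  apply/ffunP=> i; rewrite ffunE; apply: qfib.
  by have := le (l^-1%g i); rewrite permKV ffunE => ->.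
have uS : u \in staircase.
  by apply/staircaseP; exists 0 => // i; rewrite ffunE /step inE.
rewrite xu in e; apply/eqP/negPn/negP=> yu.
have [z [w [zX wX yz yw wz]]] := branching (staircase_class e uS) yu D2.
have [z' [ez _]] := class_transport cW z (esym e).
have [w' [ew ewz]] := class_transport cW w ez.
have zX' := staircase_class (class_snd cW ez) zX.
have wX' := staircase_class (class_snd cW ew) wX.
have hz := ham_class cS cW fW ez; have hw := ham_class cS cW fW ew.
have := ham_class cS cW fW ewz; rewrite wz.
(* Neighbours of [u] in the staircase lie in the piece [k = 1], hence on a single line, and cannot
   be at distance 2. *)
have line v : v \in staircase -> ham u v = 1 ->
    v = upd u (Ordinal (ltnW m_gt1)) (v (Ordinal (ltnW m_gt1))).
  move=> vX hv; have := stepE v (ltnW m_gt1); rewrite vX hv eqxx => /forallP v1.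
  apply/ffunP=> i; have [->|ii] := eqVneq i (Ordinal (ltnW m_gt1)).
    by rewrite upd_same.
  rewrite upd_other // ffunE; have := v1 i; rewrite /step ltnS leqn0.
  by rewrite -(inj_eq val_inj) in ii; rewrite (negPf ii) inE => /eqP.
rewrite (line z') -?hz // (line w') -?hw // ham_upd2.
by case: (_ != _).
Qed.

(** Piece [k] is cut out of the staircase by the sphere of radius [k] around [u], which is a fiber
    by itself. *)
Lemma step_inv k : k <= m -> edge_inv W (fun i g => g \in step k i).
Proof.
move=> km; apply: (edge_inv_prod cS cW fW) => [i|x y e].
  by rewrite /step; case: ifP => // _; apply/set0Pn; exists q; rewrite inE.
rewrite !stepE // => /andP[xX hx]; rewrite (staircase_class e xX) /=.
have [c [xc _]] := class_transport cW u e.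
have /eqP cu := staircase_origin (class_snd cW xc) (eqxx _).
by rewrite cu in xc; rewrite ham_sym -(ham_class cS cW fW xc) ham_sym.
Qed.

Lemma staircase_set_inv : edge_inv W (fun _ g => g \in Delta).
Proof.
by apply: edge_inv_ext (step_inv (leqnn m)) => i g; rewrite /step ltn_ord.
Qed.

(** Piece [k] meets [Delta] exactly in the directions below [k]; comparing [k = i] with [k = i + 1]
    isolates [i]. *)
Lemma staircase_coord_inv i : edge_inv W (fun j _ => j == i).
Proof.
have lt_inv k : k <= m -> edge_inv W (fun j _ => j < k).
  move=> km; have H := edge_inv_exists cS cW fW (edge_invI staircase_set_inv (step_inv km)).
  apply: edge_inv_ext H => j _; apply/existsP/idP=> [[g /andP[gD]]|jk].
    by rewrite /step; case: ifP => // _; rewrite inE => /eqP gq; rewrite gq (negPf qDelta) in gD.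
  by have /set0Pn[g gD] := Delta0; exists g; rewrite /step jk gD.
have H := edge_invI (lt_inv i.+1 (ltn_ord i)) (edge_invN (lt_inv i (ltnW (ltn_ord i)))).
by apply: edge_inv_ext H => j _; rewrite -leqNgt ltnS -eqn_leq val_eqE.
Qed.

End Staircase.

(** * Antisymmetry and the choice of staircase *)

Section Antisymmetric.
Variables (G : finType) (S : {set {set G * G}}).
Hypotheses (cS : coherent S) (aS : cc_antisymmetric S).
Local Notation sc g h := (pblock S (g, h)).

Lemma antisym_class g h : g != h -> sc g h <> sc h g.
Proof.
have pS := coherent_partition cS; move=> gh e.
have rS : rel_inv (sc g h) \in S by case: cS => _ _ + _; apply; apply: class_in.
have hg : (h, g) \in rel_inv (sc g h).
  by apply/imsetP; exists (g, h) => //; apply: mem_class.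
have E : rel_inv (sc g h) = sc g h by rewrite -[LHS](class_eq pS rS hg) e.
have /subsetP/(_ _ (mem_class pS (g, h))) := aS (class_in pS _) E.
by case/imsetP=> x _ [gx hx]; rewrite gx hx eqxx in gh.
Qed.

(** Copying [(g, q)] to start at [q] can only give [(q, g)], which antisymmetry forbids. *)
Lemma antisym_two_points g q : #|G| = 2 -> sc g g = sc q q -> g = q.
Proof.
move=> G2 e; apply/eqP/negPn/negP=> gq.
have [c [ec _]] := class_transport cS q e.
have cq : q != c by rewrite -(class_eq_pt cS ec).
have : c \in [set g; q].
  have -> : [set g; q] = setT; last by rewrite inE.
  by apply/eqP; rewrite eqEcard subsetT cardsT G2 cards2 gq.
rewrite !inE eq_sym [c == q]eq_sym (negPf cq) orbF => /eqP gc.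
by rewrite -gc in ec; apply: (antisym_class gq).
Qed.

(** With at most two points all fibers are singletons. Otherwise [D] or its complement has two
    elements; marking either marks the other. The sets [set0] and [setT] need no mark. *)
Lemma staircase_data (D : {set G}) : 1 < #|G| -> exists (Delta : {set G}) (q : G),
  [/\ q \notin Delta, Delta != set0, (forall g, sc g g = sc q q -> g = q) \/ 1 < #|Delta|
    & [\/ D = Delta, D = ~: Delta, D = set0 | D = setT]].
Proof.
move=> G_gt1; have G2 : #|G| <= 2 -> forall q g, sc g g = sc q q -> g = q.
  by move=> G2 q g; apply: antisym_two_points; apply/eqP; rewrite eqn_leq G2.
have [trivD|ntD] := boolP ((D == set0) || (D == setT)).
  have /card_gt0P[q _] := ltnW G_gt1; exists [set~ q], q.
  rewrite !inE eqxx -card_gt0 cardsC1 -subn1 subn_gt0 ltn_subRL; split=> //.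
    by have [/G2 G_fib|] := leqP #|G| 2; [left; apply: G_fib | right].
  by case/orP: trivD => /eqP->; [constructor 3 | constructor 4].
have [D0 DT] : D != set0 /\ D != setT by apply/andP; rewrite -negb_or.
have /set0Pn[q' q'D] := D0.
have /set0Pn[q] : ~: D != set0 by rewrite -setCT (inj_eq (@setC_inj G)).
rewrite inE => qD; have [D1|D1] := leqP #|D| 1; last first.
  by exists D, q; split=> //; [right | constructor 1].
have [/G2 G_fib|G_gt2] := leqP #|G| 2.
  by exists D, q; split=> //; [left; apply: G_fib | constructor 1].
exists (~: D), q'; rewrite inE q'D setCK; split=> //.
- by apply/set0Pn; exists q; rewrite inE.
- by right; rewrite -(ltn_add2l #|D|) cardsC; apply: leq_trans G_gt2; rewrite addn1 !ltnS.
- by constructor 2.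
Qed.

End Antisymmetric.

(** An empty [Pi] would make the orbit configuration itself complete, but transitivity puts two
    diagonal pairs into one orbit. *)
Lemma gen_base_Inv_nonempty m (L : {group {perm 'I_m}}) (Pi : {set {set 'I_m}}) :
  [transitive L, on [set: 'I_m] | 'P] -> 1 < m -> gen_base (Inv L) Pi -> 0 < #|Pi|.
Proof.
move=> tL m_gt1 bPi; rewrite card_gt0; apply/negP=> /eqP Pi0.
pose col (p : 'I_m * 'I_m) := [set ((l : {perm 'I_m}) p.1, l p.2) | l in L].
have colP a b a' b' : col (a, b) = col (a', b') <->
    exists2 l : {perm 'I_m}, l \in L & a' = l a /\ b' = l b.
  split=> [e|[l lL [-> ->]]].
    have : (a', b') \in col (a, b).
      by rewrite e; apply/imsetP; exists 1%g; rewrite //= !perm1.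
    by case/imsetP=> l lL [-> ->]; exists l.
  apply/setP=> p; apply/imsetP/imsetP=> -[k kL ->].
    by exists (l^-1 * k)%g; rewrite ?groupM ?groupV //= !permM !permK.
  by exists (l * k)%g; rewrite ?groupM //= !permM.
have cI : coherent (preim_partition col setT).
  apply: coherent_colouring => [a b c /colP[l _ [-> ->]] //|a b a' b' /colP[l lL [-> ->]]|].
    by apply/colP; exists l.
  move=> u v a b a' b' /colP[l lL [-> ->]].
  have E c : (col (a, c) = col (l a, l c)) * (col (c, b) = col (l c, l b)).
    by split; apply/colP; exists l.
  rewrite -(card_imset _ (@perm_inj _ l)); apply: eq_card => c.
  rewrite -[c in LHS](permKV l) mem_imset ?inE; last exact: perm_inj.
  by rewrite !E permKV.
have fI : finer (Inv L) (preim_partition col setT).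
  apply: (finerI (coherent_partition cI)) => r [a b] [a' b'] /imsetP[p _ ->].
  move/preim_classP/colP=> [l lL [-> ->]] /imsetP[k kL [-> ->]].
  by apply/imsetP; exists (k * l)%g; rewrite ?groupM // !permM.
have := gen_baseE bPi cI fI; rewrite Pi0 => /(_ _)/(completeE (coherent_partition cI)) cpl.
pose i0 := Ordinal (ltnW m_gt1); pose i1 := Ordinal m_gt1.
have [l lL il] := atransP2 tL (in_setT i0) (in_setT i1).
suff [] : (i0, i0) = (i1, i1) by [].
apply: cpl => [X|]; first by rewrite inE.
by apply/preim_classP/colP; exists l.
Qed.

(** * The bound for generalized bases *)

Section GeneralizedBase.
Variables (G : finType) (m : nat) (S : {set {set G * G}}) (L : {group {perm 'I_m}}).
Hypotheses (cS : coherent S) (aS : cc_antisymmetric S).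
Local Notation pt := {ffun 'I_m -> G}.

Definition power_set (D : {set G}) : {set pt} := [set x : pt | [forall i, x i \in D]].

Lemma power_set_inv W D : coherent W -> finer (expo S L) W ->
  union_of_fibers W (power_set D) -> edge_inv W (fun _ g => g \in D).
Proof.
move=> cW fW uD; have [-> a i g a' i' g'|D0] := eqVneq D set0; first by rewrite !inE.
apply: (edge_inv_prod cS cW fW) => // x y e.
by have := (union_of_fibersP cW _).1 uD x y e; rewrite !inE.
Qed.

Lemma expo_complete_small (W : {set {set pt * pt}}) : #|G| <= 1 -> coherent W -> cc_complete W.
Proof.
move=> G1 cW; apply: (completeI (coherent_partition cW)) => -[a b] [a' b'] _.
have eqG (x y : pt) : x = y.
  by apply/ffunP=> i; apply: (fintype_le1P G1).
by rewrite (eqG a a') (eqG b b').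
Qed.

Lemma expo_gen_base (Pi : {set {set G}}) n : gen_base S Pi -> (1 < m -> 0 < n) ->
  exists Pi', gen_base (expo S L) Pi' /\ #|Pi'| <= maxn #|Pi| n.
Proof.
move=> bPi n_gt0; have [G_le1|G_gt1] := leqP #|G| 1.
  exists set0; rewrite cards0; split=> //; apply: gen_baseI => W cW _ _.
  exact: expo_complete_small.
have [m_le1|m_gt1] := leqP m 1.
  exists [set power_set D | D in Pi]; split; last first.
    by apply: leq_trans (leq_imset_card _ _) (leq_maxl _ _).
  apply: gen_baseI => W cW fW uW.
  apply: (complete_of_coord_inv cS cW fW G_gt1 _ bPi) => [i a j g a' j' g' _ _ _|D DPi].
    have /fintype_le1P eqI : #|'I_m| <= 1 by rewrite card_ord.
    by rewrite (eqI i j) (eqI i j').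
  by apply: (power_set_inv cW fW); apply: uW; apply: imset_f.
(* [D1] is the member absorbed by the staircase. If [Pi] is empty, the staircase is one set too many
   for [#|Pi|], and [0 < n] pays for it. *)
pose D1 := odflt set0 [pick D in Pi].
have [Delta [q [qD D0 qP D1E]]] := staircase_data cS aS D1 G_gt1.
exists (staircase m Delta q |: [set power_set D | D in Pi :\ D1]); split.
  apply: gen_baseI => W cW fW uW.
  have uX : union_of_fibers W (staircase m Delta q) by apply: uW; rewrite setU11.
  have HD := staircase_set_inv cS cW fW m_gt1 qD D0 qP uX.
  apply: (complete_of_coord_inv cS cW fW G_gt1 _ bPi) => [i|D DPi].
    exact: (staircase_coord_inv cS cW fW m_gt1 qD D0 qP uX).
  have [->|DD1] := eqVneq D D1.
    case: D1E => ->; first exact: HD.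
    - by apply: edge_inv_ext (edge_invN HD) => _ g; rewrite inE.
    - by move=> a i g a' i' g' _ _ _; rewrite !inE.
    - by move=> a i g a' i' g' _ _ _; rewrite !inE.
  apply: (power_set_inv cW fW); apply: uW.
  by rewrite inE orbC imset_f // !inE DD1.
have le1 : #|Pi :\ D1| < maxn #|Pi| n.
  rewrite /D1; case: pickP => [D DPi|Pi0] /=.
    by rewrite leq_max (cardsD1 D Pi) DPi add1n leqnn.
  by rewrite (eq_card0 (A := _ :\ _)) ?leq_max ?n_gt0 ?orbT // => D; rewrite inE Pi0 andbF.
rewrite cardsU1; apply: leq_trans le1; rewrite -add1n leq_add ?leq_imset_card //.
exact: leq_b1.
Qed.

End GeneralizedBase.

(** * Points taking two values along a set of coordinates *)

Definition mix (G : finType) m (A : {set 'I_m}) (p q : G) : {ffun 'I_m -> G} :=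
  [ffun i => if i \in A then p else q].

Section Mix.
Variables (G : finType) (m : nat) (S : {set {set G * G}}) (L : {group {perm 'I_m}}).
Local Notation pt := {ffun 'I_m -> G}.
Variable W : {set {set pt * pt}}.
Hypotheses (cS : coherent S) (cW : coherent W) (fW : finer (expo S L) W).
Implicit Types (a b c x : pt) (i j : 'I_m) (g h : G) (A : {set 'I_m}).
Local Notation wc a b := (pblock W (a, b)).
Local Notation sc g h := (pblock S (g, h)).

(** If a direction in [A] matched one outside, the first point would match [p] with [q] and the
    second [q] with [p], so the edge from [p] to [q] would match its reverse. *)
Lemma swap_set_inv A p q : sc p q <> sc q p ->
  edge_inv W (fun i g => g == mix A p q i) -> edge_inv W (fun i g => g == mix A q p i) ->
  edge_inv W (fun i _ => i \in A).
Proof.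
move=> pq H1 H2; apply: edge_invW => a i g a' i' g' ga ga' e iA; apply/negPn/negP=> iA'.
have qp : q != p by apply: contraPneq pq => ->; case.
have [h [k [k' [kp kh]]]] := edge_rebase cS cW fW p ga ga' e.
set c := upd a i p; set c' := upd a' i' h => ec.
have kc : k != c i by rewrite upd_same.
have kc' : k' != c' i' by rewrite upd_same.
have hq : h = q.
  have := H1 _ _ _ _ _ _ kc kc' ec; rewrite !upd_same !ffunE iA (negPf iA') eqxx.
  by move/esym/eqP.
have [h2 [e2 _]] := line_transport cS cW fW q kc kc' ec.
have qc : q != c i by rewrite upd_same.
have hc' : h2 != c' i'.
  have := ham_class cS cW fW e2; rewrite !ham_upd qc.
  by case: (_ != _).
have h2p : h2 = p.
  have e3 : wc (upd c i q) (upd (upd c i q) i p) = wc (upd c' i' h2) (upd (upd c' i' h2) i' h).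
    by have := class_inv cW e2; rewrite /c /c' !upd_upd.
  have pd : p != upd c i q i by rewrite upd_same eq_sym.
  have hd : h != upd c' i' h2 i' by rewrite upd_same eq_sym; rewrite upd_same in hc'.
  have := H2 _ _ _ _ _ _ pd hd e3; rewrite !upd_same !ffunE iA (negPf iA') eqxx.
  by move/esym/eqP.
have := edge_class cS cW fW qc hc' e2.
by rewrite !upd_same hq h2p.
Qed.

Lemma swap_pt_inv A p q : edge_inv W (fun i _ => i \in A) ->
  edge_inv W (fun i g => g == mix A p q i) -> edge_inv W (fun i g => g == mix A q p i) ->
  edge_inv W (fun _ g => g == p).
Proof.
move=> HA H1 H2.
apply: edge_inv_ext (edge_invU (edge_invI HA H1) (edge_invI (edge_invN HA) H2)) => i g.
by rewrite !ffunE; case: (i \in A); rewrite /= ?orbF.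
Qed.

(** Once [p] is marked, [A] consists of the directions in which the mixed point takes the value
    [p]. *)
Lemma marked_set_inv A p q : p != q -> edge_inv W (fun _ g => g == p) ->
  edge_inv W (fun i g => g == mix A p q i) -> edge_inv W (fun i _ => i \in A).
Proof.
move=> pq H1 H2.
apply: edge_inv_ext (edge_inv_exists cS cW fW (edge_invI H1 H2)) => i _.
apply/existsP/idP=> [[g]|iA]; last by exists p; rewrite ffunE iA eqxx.
by rewrite ffunE; case: ifP => // _ /andP[/eqP-> pq']; rewrite pq' in pq.
Qed.

End Mix.

(** * Recovering the coordinates around a marked constant point *)

Section Star.
Variables (G : finType) (m : nat) (S : {set {set G * G}}) (L : {group {perm 'I_m}}).
Local Notation pt := {ffun 'I_m -> G}.
Variable W : {set {set pt * pt}}.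
Hypotheses (cS : coherent S) (cW : coherent W) (fW : finer (expo S L) W).
Hypotheses (aS : cc_antisymmetric S) (tL : [transitive L, on [set: 'I_m] | 'P]).
Implicit Types (a b c x y z : pt) (i j : 'I_m) (g h : G) (A : {set 'I_m}).
Local Notation wc a b := (pblock W (a, b)).
Local Notation sc g h := (pblock S (g, h)).
Variables (b0 g0 : G).
Hypotheses (g0b0 : g0 != b0) (b0_inv : edge_inv W (fun _ g => g == b0)).

Let alpha : pt := [ffun=> b0].

(** An edge leaving [y] where [y i] is not [b0] would match an edge leaving [alpha], which starts at
    the marked value [b0]. *)
Lemma const_fiber : fiber_inv W (pred1 alpha).
Proof.
move=> x y e /eqP xa; rewrite {x}xa in e; apply/eqP/ffunP=> i; rewrite ffunE.
apply/eqP/negPn/negP=> yi.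
have [c' [yc _]] := class_transport cW (upd y i b0) (esym e).
have b0y : b0 != y i by rewrite eq_sym.
have [i' [g' [ga' c'E]]] : exists i' g', g' != alpha i' /\ c' = upd alpha i' g'.
  by apply: ham1; rewrite -(ham_class cS cW fW yc) ham_upd b0y.
rewrite c'E in yc; have := b0_inv b0y ga' yc.
by rewrite ffunE eqxx (negPf yi).
Qed.

Lemma class_alpha z z' : wc z z = wc z' z' -> wc alpha z = wc alpha z'.
Proof.
move=> e; have [c [za _]] := class_transport cW alpha e.
have /eqP ca := const_fiber (class_snd cW za) (eqxx _).
by rewrite ca in za; apply: class_inv za.
Qed.

(* The points of the star are the neighbours of [alpha] in the relation of [(b0, g0)]:
   its lines through [alpha] are the coordinates. *)
Definition star z := [exists i, exists g, (z == upd alpha i g) && (sc b0 g == sc b0 g0)].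

Lemma starP z :
  reflect (exists i g, [/\ z = upd alpha i g, g != b0 & sc b0 g = sc b0 g0]) (star z).
Proof.
apply: (iffP existsP) => [[i /existsP[g /andP[/eqP-> /eqP e]]]|[i [g [-> _ e]]]].
  by exists i, g; split=> //; rewrite eq_sym (class_eq_pt cS e) eq_sym.
by exists i; apply/existsP; exists g; rewrite eqxx e eqxx.
Qed.

Lemma star_edge i g : sc b0 g = sc b0 g0 -> g != b0 -> star (upd alpha i g).
Proof. by move=> e gb; apply/starP; exists i, g. Qed.

Lemma star_fiber z z' : wc z z = wc z' z' -> star z -> star z'.
Proof.
move=> e /starP[i [g [zE gb ge]]]; have := class_alpha e; rewrite zE => e'.
have [i' [g' [ga' z'E]]] : exists i' g', g' != alpha i' /\ z' = upd alpha i' g'.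
  by apply: ham1; rewrite -(ham_class cS cW fW e') ham_upd ffunE gb.
rewrite z'E in e' *; have gb' : g' != b0 by rewrite ffunE in ga'.
have ga : g != alpha i by rewrite ffunE.
by apply: star_edge => //; have := edge_class cS cW fW ga ga' e'; rewrite !ffunE ge.
Qed.

Variable i0 : 'I_m.
(** The default [i0] occurs only at [alpha], which is not in the star. *)
Definition star_dir z := odflt i0 [pick i | z i != b0].

Lemma star_dirE i g : g != b0 -> star_dir (upd alpha i g) = i.
Proof.
move=> gb; rewrite /star_dir; case: pickP => /= [j|/(_ i)]; last by rewrite upd_same gb.
by have [//|ji] := eqVneq j i; rewrite upd_other // ffunE eqxx.
Qed.

(** Star points in one direction are at distance at most 1, those in different directions at
    distance 2. *)
Lemma star_dir_class a b a' b' : star a -> star b -> star a' -> star b' ->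
  wc a b = wc a' b' -> star_dir a = star_dir b -> star_dir a' = star_dir b'.
Proof.
move=> /starP[i [g [-> gb _]]] /starP[j [h [-> hb _]]] /starP[i' [g' [-> gb' _]]].
move=> /starP[j' [h' [-> hb' _]]] e; rewrite !star_dirE // => ij; apply/eqP/negPn/negP=> ij'.
have := ham_class cS cW fW e.
by rewrite ij ham_upd2 (ham_upd_distinct ij') ?ffunE //; case: (_ != _).
Qed.

Lemma star_dir_onto i : exists2 a, star a & star_dir a = i.
Proof. by exists (upd alpha i g0); [apply: star_edge | rewrite star_dirE]. Qed.

(* Antisymmetry orders the two coordinates in which two points of the star differ. *)
Lemma star_Inv a b a' b' : star a -> star b -> star a' -> star b' -> wc a b = wc a' b' ->
  exists2 l : {perm 'I_m}, l \in L &
    l (star_dir a) = star_dir a' /\ l (star_dir b) = star_dir b'.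
Proof.
move=> sa sb sa' sb' e; have [ab|ab] := eqVneq (star_dir a) (star_dir b).
  rewrite -ab -(star_dir_class sa sb sa' sb' e ab).
  have [l lL il] := atransP2 tL (in_setT (star_dir a)) (in_setT (star_dir a')).
  by exists l.
have ab' : star_dir a' != star_dir b'.
  by apply: contra_neq ab; apply: star_dir_class (esym e).
have anti := antisym_class cS aS g0b0.
move: sa sb sa' sb' e ab ab' => /starP[i [g [-> gb ge]]] /starP[j [h [-> hb he]]].
move=> /starP[i' [g' [-> gb' ge']]] /starP[j' [h' [-> hb' he']]] e; rewrite !star_dirE //.
move=> ij ij'; have [l lL le] := expo_class cS cW fW e; exists l => //.
have inv u v : sc b0 u = sc b0 v -> sc u b0 = sc v b0 by apply: class_inv.
split; apply/eqP/negPn/negP=> ne.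
  have := le i; rewrite upd_same upd_other // ffunE (inv _ _ ge) (upd_other _ _ ne) ffunE.
  have [->|ne'] := eqVneq (l i) j'; first by rewrite upd_same he'.
  by rewrite upd_other // ffunE => /(class_eq_pt cS); rewrite eqxx (negPf g0b0).
have := le j; rewrite upd_same upd_other 1?eq_sym // ffunE he.
rewrite [upd _ j' _ _]upd_other // [alpha _]ffunE.
have [->|ne'] := eqVneq (l j) i'; first by rewrite upd_same (inv _ _ ge') => /esym.
by rewrite upd_other // ffunE => /(class_eq_pt cS); rewrite eqxx eq_sym (negPf g0b0).
Qed.

Lemma star_coord_fiber Sigma : gen_base (Inv L) Sigma ->
  (forall A, A \in Sigma -> edge_inv W (fun i _ => i \in A)) ->
  forall a a', star a -> wc a a = wc a' a' -> star_dir a = star_dir a'.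
Proof.
move=> bS hS a a' sa e.
have cQ := coherent_quotient_config cW star_fiber star_dir_class star_dir_onto.
have pQ := coherent_partition cQ.
have cplQ : cc_complete (quotient_config W star star_dir).
  apply: (gen_baseE bS cQ) => [|A AS].
    apply: (finerI pQ) => r [x y] [x' y'] /imsetP[p _ ->].
    have [z sz <-] := star_dir_onto x; have [w sw <-] := star_dir_onto y.
    case/(quotient_config_lift sz sw) => z' [w' [sz' sw' <- <- ezw]].
    have [l lL [<- <-]] := star_Inv sz sw sz' sw' ezw.
    by case/imsetP=> k kL [-> ->]; apply/imsetP; exists (k * l)%g; rewrite ?groupM ?permM.
  apply/(union_of_fibersP cQ) => x y; have [z sz <-] := star_dir_onto x.
  case/(quotient_config_lift sz sz) => z' [w' [sz' sw' <- _ /(class_fst cW) ez]].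
  have := class_alpha ez; case/starP: sz => i [g [-> gb _]]; case/starP: sz' => i' [g' [-> gb' _]].
  rewrite !star_dirE // => /(hS _ AS _ _ _ _ _ _) H; rewrite H ?ffunE //.
suff /(completeE pQ cplQ)[] : pblock (quotient_config W star star_dir) (star_dir a, star_dir a)
    = pblock (quotient_config W star star_dir) (star_dir a', star_dir a') by [].
have sa' := star_fiber e sa.
exact: (quotient_config_class cW star_fiber star_dir_class).
Qed.

(** The star points in direction [i0] form a product set [X] that is a union of fibers, and [i0] is
    the only direction in which [X] misses the marked value [b0]. *)
Lemma star_coord_inv Sigma : gen_base (Inv L) Sigma ->
  (forall A, A \in Sigma -> edge_inv W (fun i _ => i \in A)) ->
  edge_inv W (fun j _ => j == i0).
Proof.
move=> bS hS; have fS := star_coord_fiber bS hS.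
pose X j := if j == i0 then [set g | sc b0 g == sc b0 g0] else [set b0].
have b0N : (sc b0 b0 == sc b0 g0) = false.
  by apply/negP=> /eqP/(class_eq_pt cS); rewrite eqxx eq_sym (negPf g0b0).
have XE z : [forall j, z j \in X j] = star z && (star_dir z == i0).
  apply/forallP/andP=> [zX|[/starP[i [g [-> gb ge]]]]].
    have zE : z = upd alpha i0 (z i0).
      apply/ffunP=> j; have [->|ji] := eqVneq j i0; first by rewrite upd_same.
      by rewrite upd_other // ffunE; have := zX j; rewrite /X (negPf ji) inE => /eqP.
    have := zX i0; rewrite /X eqxx inE => /eqP zi.
    have zb : z i0 != b0 by apply: contraFneq b0N => zb; rewrite -zi zb.
    by rewrite zE star_dirE //; split=> //; apply: star_edge.
  rewrite star_dirE // => /eqP -> j; rewrite /X.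
  by have [->|ji] := eqVneq j i0; rewrite ?upd_same ?upd_other // ?ffunE inE // ge.
have H : edge_inv W (fun j g => g \in X j).
  apply: (edge_inv_prod cS cW fW) => [j|x y e].
    by apply/set0Pn; rewrite /X; case: eqP => _; [exists g0 | exists b0]; rewrite inE.
  rewrite !XE => /andP[sx /eqP <-]; rewrite (star_fiber e sx) /=.
  by rewrite (fS _ _ sx e).
have H2 := edge_invN (edge_inv_exists cS cW fW (edge_invI b0_inv H)).
apply: edge_inv_ext H2 => j _; rewrite /X; case: (eqVneq j i0) => _.
  by apply/existsP=> -[g /andP[/eqP->]]; rewrite inE b0N.
by apply/negbTE/negPn/existsP; exists b0; rewrite inE !eqxx.
Qed.

End Star.

(** * The bound for bases *)

Section Base.
Variables (G : finType) (m : nat) (S : {set {set G * G}}) (L : {group {perm 'I_m}}).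
Local Notation pt := {ffun 'I_m -> G}.
Hypotheses (cS : coherent S) (aS : cc_antisymmetric S).
Hypothesis tL : [transitive L, on [set: 'I_m] | 'P].

Lemma not_complete_gt1 : ~ cc_complete S -> 1 < #|G|.
Proof.
move=> ncS; rewrite ltnNge; apply/negP=> /fintype_le1P eqG; apply: ncS.
apply: (completeI (coherent_partition cS)) => -[a b] [a' b'] _.
by rewrite (eqG a a') (eqG a b) (eqG a b').
Qed.

Lemma base_nonempty (B : {set G}) : ~ cc_complete S -> base S B -> 0 < #|B|.
Proof.
move=> ncS bB; rewrite card_gt0; apply/negP=> /eqP B0; apply: ncS.
apply: (gen_baseE bB cS) => [r //|X].
by rewrite B0 imset0 inE.
Qed.

Section Points.
Variables (B : {set G}) (Sigma : {set {set 'I_m}}) (g1 : G).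

Let n := #|B|.
Let beta k := nth g1 (enum B) k.
(** When pairs outnumber [Sigma], the default [set0] makes the surplus base points constant. *)
Let A k := nth set0 (enum Sigma) k.

(* Consecutive base points are paired; an unpaired last one is its own partner. *)
Definition partner k := if odd k then k.-1 else if k.+1 < n then k.+1 else k.
Definition base_pt k : pt := mix (A k./2) (beta k) (beta (partner k)).
Definition extra_pt k : pt := mix (A k) (beta 0) g1.
Definition expo_base : {set pt} :=
  [set base_pt k | k : 'I_n] :|: [set extra_pt (n./2 + k) | k : 'I_(#|Sigma| - n./2)].

Lemma card_expo_base : #|expo_base| <= n + (#|Sigma| - n./2).
Proof.
apply: leq_trans (leq_card_setU _ _) _.
by apply: leq_add; apply: leq_trans (leq_imset_card _ _) _; rewrite card_ord.
Qed.

Hypotheses (n_gt0 : 0 < n) (g1P : beta 0 != g1).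
Hypotheses (bB : base S B) (bSigma : gen_base (Inv L) Sigma).

Lemma expo_baseP : base (expo S L) expo_base.
Proof.
apply: gen_baseI => W cW fW uW.
have ptI x : x \in expo_base -> edge_inv W (fun i g => g == x i).
  move=> xB; apply: (edge_inv_pt cS cW fW) => y z e /eqP yx.
  have /(union_of_fibersP cW)/(_ y z e) := uW _ (imset_f _ xB).
  by rewrite yx !inE eqxx => ->.
have bI k : k < n -> edge_inv W (fun i g => g == base_pt k i).
  by move=> kn; apply: ptI; rewrite inE; apply/orP; left; apply/imsetP; exists (Ordinal kn).
have pair k : k.*2.+1 < n -> [/\ edge_inv W (fun i _ => i \in A k),
    edge_inv W (fun _ g => g == beta k.*2) & edge_inv W (fun _ g => g == beta k.*2.+1)].
  move=> kn; have x1 := bI _ (ltnW kn); have x2 := bI _ kn.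
  rewrite /base_pt /partner odd_double kn doubleK in x1.
  rewrite /base_pt /partner oddS odd_double /= uphalf_double in x2.
  have ne : beta k.*2 != beta k.*2.+1.
    by rewrite nth_uniq ?enum_uniq -?cardE // ?neq_ltn ?ltnS ?leqnn // ltnW.
  have HA := swap_set_inv cS cW fW (antisym_class cS aS ne) x1 x2.
  by split=> //; [apply: swap_pt_inv HA x1 x2 | apply: swap_pt_inv HA x2 x1].
(* An unpaired last base point yields a constant point, which marks it directly. *)
have betaI k : k < n -> edge_inv W (fun _ g => g == beta k).
  move=> kn; have := odd_double_half k; case: (boolP (odd k)) => ok kE.
    by have [|_ _] := pair k./2; rewrite -[_.*2.+1]add1n kE.
  rewrite add0n in kE; have [kn'|kn'] := ltnP k.+1 n.
    by have [|_ + _] := pair k./2; rewrite kE.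
  apply: edge_inv_ext (bI k kn) => i g.
  by rewrite ffunE /partner (negPf ok) ltnNge kn' /=; case: ifP.
(* The first [n./2] sets come from the swapped pairs, the others from the extra points through the
   marked value [beta 0]. *)
have AI k : k < #|Sigma| -> edge_inv W (fun i _ => i \in A k).
  move=> kb; have [kn|nk] := ltnP k n./2.
    by have [] // := pair k; rewrite geq_half_double doubleS in kn.
  have kE : k - n./2 < #|Sigma| - n./2 by rewrite ltn_sub2r // (leq_ltn_trans nk).
  apply: (marked_set_inv cS cW fW g1P (betaI 0 n_gt0)).
  apply: ptI; rewrite inE; apply/orP; right; apply/imsetP; exists (Ordinal kE) => //=.
  by rewrite subnKC.
have b0I := betaI 0 n_gt0.
apply: (complete_of_coord_inv cS cW fW _ _ bB) => [|i|X /imsetP[g gB ->]].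
- by apply: leq_trans (max_card [set beta 0; g1]); rewrite cards2 g1P.
- apply: (star_coord_inv cS cW fW aS tL (g0 := g1) _ b0I i bSigma); first by rewrite eq_sym.
  move=> X; rewrite -mem_enum => XS; rewrite -(nth_index set0 XS); apply: AI.
  by rewrite cardE index_mem.
- have gB' : g \in enum B by rewrite mem_enum.
  have := betaI (index g (enum B)); rewrite /n cardE index_mem => /(_ gB') H.
  by apply: edge_inv_ext H => i h; rewrite /beta nth_index // inE.
Qed.

End Points.

Lemma expo_base_bound (B : {set G}) (Sigma : {set {set 'I_m}}) :
  ~ cc_complete S -> base S B -> gen_base (Inv L) Sigma ->
  exists B' : {set pt}, base (expo S L) B' /\ #|B'| <= #|B| + (#|Sigma| - #|B|./2).
Proof.
move=> ncS bB bSigma; have B_gt0 := base_nonempty ncS bB.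
have /card_gt0P[g gB] := B_gt0.
have [g1 g1P] := exists_neq (not_complete_gt1 ncS) (nth g (enum B) 0).
exists (expo_base B Sigma g1); split; last exact: card_expo_base.
(* [beta] has default [g1], whereas [g1] was chosen with default [g]; they agree since [B] is
   nonempty. *)
apply: expo_baseP => //; rewrite (set_nth_default g) -?cardE //.
by rewrite eq_sym.
Qed.

End Base.

Theorem theorem7p1 (G : finType) (S : {set {set G * G}}) (m : nat)
    (L : {group {perm 'I_m}}) :
  coherent S -> cc_antisymmetric S ->
  [transitive L, on [set: 'I_m] | 'P] -> odd #|L| ->
  (forall gY b, is_gb S gY -> is_gb (Inv L) b ->
     exists Pi, gen_base (expo S L) Pi /\ #|Pi| <= maxn gY b) /\
  (~ cc_complete S -> forall bY b, is_b S bY -> is_gb (Inv L) b ->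
     exists B, base (expo S L) B /\ #|B| <= bY + (b - (bY.-1.+1 %/ 2))).
Proof.
move=> cS aS tL _; split=> [_ _ [[Pi [bPi <-]] _] [[Sigma [bSigma <-]] _]|ncS].
  apply: expo_gen_base => // m_gt1.
  exact: gen_base_Inv_nonempty bSigma.
move=> _ _ [[B [bB <-]] _] [[Sigma [bSigma <-]] _].
(* A base is nonempty here, so the rounded-up half of [#|B| - 1] equals [#|B|./2], the number of
   swapped pairs. *)
rewrite prednK ?(base_nonempty cS ncS bB) // divn2.
exact: expo_base_bound.
Qed.
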